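(* Let $k$ be a field, let $n\ge1$ be an integer, let $R^{(n)}=k[x^iy^{n-i}\mid 0\le i\le n]$ denote the $n$th Veronese subring of $R=k[x,y]$, and let $[n]\cup\{0\}=\{0,1,\dots,n\}$. Then $\operatorname{ms}(R^{(n)})=2$ and $$\operatorname{cs}(R^{(n)})\le\min\{|S| : S\subseteq[n]\cup\{0\}\text{ and }S+S=[2n]\cup\{0\}\}.$$
   Context: $S+S=\{s+t: s,t\in S\}$ and $[2n]\cup\{0\}=\{0,1,\dots,2n\}$. $R^{(n)}$ is a standard graded $k$-algebra in which each generator $x^iy^{n-i}$ has degree one; its homogeneous maximal ideal is $\mathfrak m=(x^iy^{n-i}\mid0\le i\le n)$. For a standard graded $k$-algebra $A$ with homogeneous maximal ideal $\mathfrak m$ and a homogeneous ideal $I$, $\mu(I)=\dim_k(I/\mathfrak mI)$, and $$\operatorname{cs}(A)=\min\{\mu(I): I\subseteq\mathfrak m \text{ a homogeneous ideal with } I^2=\mathfrak m^2\},\qquad \operatorname{ms}(A)=\min\{\mu(I): I\subseteq \mathfrak m \text{ a homogeneous ideal with } I\supseteq \mathfrak m^2\}.$$ *)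

(* Defs.v *)
(* Mathematical Components, with the classical logic of mathcomp-classical. *)
From HB Require Import structures.
From mathcomp Require Import all_boot all_order all_algebra.
From mathcomp Require Import finmap boolp classical_sets mpoly.

Set Implicit Arguments.
Unset Strict Implicit.
Unset Printing Implicit Defensive.

Import GRing.Theory.

Local Open Scope classical_set_scope.
Local Open Scope ring_scope.

Definition is_min (P : set nat) (m : nat) : Prop :=
  P m /\ forall m', P m' -> (m <= m')%N.

Section GradedAlgebras.
Context {k : fieldType} {A : comAlgType k}.
Implicit Types (I J : set A) (gr : nat -> set A).

Definition is_ideal I : Prop :=
  [/\ I 0, forall a b, I a -> I b -> I (a + b) & forall a b, I b -> I (a * b)].

(* The finite sums of products uv with u in I and v in J; for ideals I and J
   this is the product ideal I J. *)
Definition mulset I J : set A :=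
  [set a | exists2 s : seq (A * A),
     (forall p, p \in s -> I p.1 /\ J p.2) & a = \sum_(p <- s) p.1 * p.2].

(* dim_k (I / J) = d, for k-subspaces J of I: e_0, ..., e_(d-1) is a family in
   I whose classes form a basis of I / J. *)
Definition has_dim_quot I J (d : nat) : Prop :=
  exists e : 'I_d -> A,
    [/\ forall i, I (e i),
        forall c : 'I_d -> k, J (\sum_i c i *: e i) -> forall i, c i = 0
      & forall a, I a -> exists c : 'I_d -> k, J (a - \sum_i c i *: e i)].

(* gr d is the homogeneous piece of degree d: A is the direct sum of the
   pieces, the piece of degree 0 is k, and A is generated over k by the piece
   of degree 1, which is finite dimensional. *)
Record standard_graded gr : Prop := StandardGraded {
  sg_submod : forall d, [/\ gr d 0, forall a b, gr d a -> gr d b -> gr d (a + b)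
                         & forall (c : k) a, gr d a -> gr d (c *: a)];
  sg_direct : forall N (f : nat -> A), (forall d, gr d (f d)) ->
    \sum_(d < N) f d = 0 -> forall d, (d < N)%N -> f d = 0;
  sg_total : forall a, exists N, exists2 f : nat -> A,
    (forall d, gr d (f d)) & a = \sum_(d < N) f d;
  sg_mul : forall d e a b, gr d a -> gr e b -> gr (d + e)%N (a * b);
  sg_deg0 : gr 0%N = [set a | exists c : k, a = c%:A];
  sg_gen1 : forall d, gr d.+1 `<=` mulset (gr 1%N) (gr d);
  sg_findim1 : exists m (e : 'I_m -> A), forall a, gr 1%N a ->
    exists c : 'I_m -> k, a = \sum_i c i *: e i }.

Definition maxideal gr : set A :=
  [set a | exists N, exists2 f : nat -> A,
     (forall d, gr d.+1 (f d)) & a = \sum_(d < N) f d].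

(* I is the sum of its intersections with the pieces. *)
Definition homogeneous gr I : Prop :=
  forall a, I a -> exists N, exists2 f : nat -> A,
    (forall d, gr d (f d) /\ I (f d)) & a = \sum_(d < N) f d.

Definition is_mu gr I (d : nat) : Prop :=
  has_dim_quot I (mulset (maxideal gr) I) d.

(* Values of mu and of the minima are given by their graphs, so that an
   infinite dimension or an empty minimum has no value. *)
Definition is_cs gr (c : nat) : Prop :=
  is_min [set d | exists I : set A,
    [/\ is_ideal I, homogeneous gr I, I `<=` maxideal gr,
        mulset I I = mulset (maxideal gr) (maxideal gr) & is_mu gr I d]] c.

Definition is_ms gr (c : nat) : Prop :=
  is_min [set d | exists I : set A,
    [/\ is_ideal I, homogeneous gr I, I `<=` maxideal gr,
        mulset (maxideal gr) (maxideal gr) `<=` I & is_mu gr I d]] c.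

End GradedAlgebras.

Section Veronese.
Variables (k : fieldType) (n : nat).

Definition vgen : n.+1.-tuple {mpoly k[2]} :=
  [tuple 'X_0 ^+ i * 'X_1 ^+ (n - i) | i < n.+1].

(* The k-subalgebra generated by the x^i y^(n-i), as the image of the
   evaluation map from the polynomial ring in n+1 variables. *)
Definition veronese_pred : {pred {mpoly k[2]}} :=
  [pred p | `[< exists q : {mpoly k[n.+1]}, p = q \mPo vgen >]].

Fact veroneseP p :
  reflect (exists q : {mpoly k[n.+1]}, p = q \mPo vgen) (p \in veronese_pred).
Proof. exact: asboolP. Qed.

Fact veronese_subalg_closed : subalg_closed veronese_pred.
Proof.
split=> [|c _ _ /veroneseP[p ->] /veroneseP[q ->]
         |_ _ /veroneseP[p ->] /veroneseP[q ->]]; apply/veroneseP.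
- by exists 1; rewrite comp_mpoly1.
- by exists (c *: p + q); rewrite linearP.
- by exists (p * q); rewrite rmorphM.
Qed.

HB.instance Definition _ :=
  GRing.isSubalgClosed.Build k {mpoly k[2]} veronese_pred veronese_subalg_closed.

Record veronese : Type :=
  Veronese { vval : {mpoly k[2]}; _ : vval \in veronese_pred }.

HB.instance Definition _ := [isSub for vval].
HB.instance Definition _ := [Choice of veronese by <:].
HB.instance Definition _ := [SubChoice_isSubAlgebra of veronese by <:].
HB.instance Definition _ := [SubNzRing_isSubComNzRing of veronese by <:].

(* Each generator x^i y^(n-i) has degree one. *)
Definition veronese_gr (d : nat) : set veronese :=
  [set a | exists2 q : {mpoly k[n.+1]},
     q \is d.-homog & val a = q \mPo vgen].


(* q evaluated at the generators; vev 'X_i is x^i y^(n-i). *)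
Definition vev (q : {mpoly k[n.+1]}) : veronese :=
  Veronese (introT (veroneseP _) (ex_intro _ q (erefl (q \mPo vgen)))).

Fact vevP (a : veronese) : exists q, a = vev q.
Proof. by case: a => p Hp; case/veroneseP: (Hp) => q ?; exists q; apply: val_inj. Qed.

Fact vev_linear : linear vev.
Proof. by move=> c p q; apply: val_inj; rewrite linearP /= linearP. Qed.

HB.instance Definition _ :=
  GRing.isLinear.Build k {mpoly k[n.+1]} veronese _ vev vev_linear.

Fact vevM p q : vev (p * q) = vev p * vev q.
Proof. by apply: val_inj; rewrite [RHS]rmorphM /= rmorphM. Qed.

Fact vev1 : vev 1 = 1.
Proof. by apply: val_inj; rewrite [RHS]rmorph1 /= comp_mpoly1. Qed.

Fact veronese_grP d a :
  veronese_gr d a <-> exists2 q : {mpoly k[n.+1]}, q \is d.-homog & a = vev q.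
Proof.
split=> [] [q hq e]; exists q => //; first exact: val_inj.
by rewrite e.
Qed.

Fact dhomog_vev d (q : {mpoly k[n.+1]}) :
  q \is d.-homog -> val (vev q) \is (n * d).-homog.
Proof.
move=> /dhomogP hq /=; rewrite comp_mpolyE big_seq.
apply: rpred_sum => m /hq <-; apply: rpredZ.
have -> : (n * mdeg m)%N = (n * \sum_i m i)%N by rewrite -mdegE.
rewrite big_distrr /=.
apply: (big_rec2 (fun (e : nat) (p : {mpoly k[2]}) => p \is e.-homog)).
  exact: dhomog1.
move=> i e p _ hp; apply: dhomogM => //; apply: dhomogMn.
rewrite tnth_mktuple -[n in n.-homog](subnKC (leq_ord i)).
by apply: dhomogM; rewrite -[X in X.-homog]mul1n; apply: dhomogMn;
  rewrite dhomogX /= mdeg1.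
Qed.

Fact veronese_gr1 a : veronese_gr 1 a ->
  exists c : 'I_n.+1 -> k, a = \sum_i c i *: vev 'X_i.
Proof.
move=> /veronese_grP[q /dhomogP hq ->].
exists (fun i => q@_U_(i)).
transitivity (vev (\sum_i q@_U_(i) *: 'X_i)); last first.
  by rewrite linear_sum; apply: eq_bigr => i _; rewrite linearZ.
congr vev; apply/mpolyP=> m; rewrite raddf_sum /=.
under eq_bigr do rewrite mcoeffZ mcoeffX.
have [/mdeg1P[j /eqP ->]|m1] := boolP (mdeg m == 1%N).
  rewrite (bigD1 j) //= eqxx mulr1 big1 ?addr0 // => i ij.
  rewrite (_ : (_ == _) = false) ?mulr0 //; apply: contraNF ij => /eqP/mnmP.
  by move=> /(_ i); rewrite !mnm1E eqxx eq_sym; case: eqP.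
rewrite memN_msupp_eq0; last first.
  by apply: contra m1 => mq; apply/eqP; exact: hq.
rewrite big1 // => i _; rewrite (_ : (_ == _) = false) ?mulr0 //.
by apply: contraNF m1 => /eqP <-; rewrite mdeg1.
Qed.

Fact veronese_standard_graded : (0 < n)%N -> standard_graded veronese_gr.
Proof.
move=> n_gt0; split.
- move=> d; split.
  + by apply/veronese_grP; exists 0; rewrite ?rpred0 ?linear0.
  + move=> _ _ /veronese_grP[p hp ->] /veronese_grP[q hq ->].
    by apply/veronese_grP; exists (p + q); rewrite ?rpredD ?linearD.
  + move=> c _ /veronese_grP[p hp ->].
    by apply/veronese_grP; exists (c *: p); rewrite ?rpredZ ?linearZ.
- move=> N f hf s0 d dN; apply: val_inj; rewrite raddf0.
  have hfh e : val (f e) \is (n * e).-homog.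
    by case/veronese_grP: (hf e) => q hq ->; apply: dhomog_vev.
  have := congr1 (pihomog mdeg (n * d)%N) (congr1 val s0).
  rewrite !raddf_sum !raddf0 (bigD1 (Ordinal dN)) //= pihomog_dE //.
  rewrite big1 ?addr0 // => i ne; apply: pihomog_ne0 (hfh i).
  by rewrite eqn_pmul2l.
- move=> a; case: (vevP a) => q ->; exists (msize q).
  exists (fun d => vev (pihomog mdeg d q)).
    move=> d; apply/veronese_grP; exists (pihomog mdeg d q) => //; exact: pihomogP.
  by rewrite -linear_sum -pihomog_partitionE.
- move=> d e _ _ /veronese_grP[p hp ->] /veronese_grP[q hq ->].
  by apply/veronese_grP; exists (p * q); [exact: dhomogM | rewrite vevM].
- apply/seteqP; split=> [_ /veronese_grP[q /dhomogP hq ->]|_ [c ->]].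
    exists q@_0; rewrite -vev1 -linearZ /=; congr vev.
    apply/mpolyP=> m; rewrite -mul_mpolyC mulr1 mcoeffC.
    case: (eqVneq 0%MM m) => [<-|ne0]; first by rewrite mulr1.
    rewrite mulr0; apply: memN_msupp_eq0; apply: contra ne0 => /hq.
    by move=> /eqP; rewrite mdeg_eq0 eq_sym.
  apply/veronese_grP; exists (c *: 1); last by rewrite linearZ /= vev1.
  by rewrite rpredZ ?dhomog1.
- move=> d _ /veronese_grP[q /dhomogP hq ->].
  have H m : exists i : 'I_n.+1, m \in msupp q -> (U_(i) <= m)%MM.
    have [mq|] := boolP (m \in msupp q); last by exists ord0.
    have : mdeg m != 0%N by rewrite hq.
    rewrite mdeg_eq0 => /eqP mne0.
    have [i mi] : exists i, m i != 0%N.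
      apply: contra_notP mne0 => /forallNP h; apply/mnmP => i; rewrite mnm0E.
      by apply/eqP; apply: contra_notT (h i).
    by exists i => _; rewrite lep1mP.
  have [g hg] := choice H.
  exists [seq (vev (q@_m *: 'X_(g m)), vev 'X_[m - U_(g m)]) | m <- msupp q].
    move=> _ /mapP[m mq ->] /=; split; apply/veronese_grP.
      exists (q@_m *: 'X_(g m)) => //; apply: rpredZ.
      by rewrite dhomogX /= mdeg1.
    exists 'X_[m - U_(g m)] => //; rewrite dhomogX /=.
    have /(congr1 mdeg) := submK (hg m mq); rewrite mdegD mdeg1 addn1.
    by rewrite [mdeg m]hq // => -[->].
  rewrite big_map {1}[q]mpolyE linear_sum /= big_seq [RHS]big_seq.
  apply: eq_bigr => m mq; rewrite -vevM -scalerAl -mpolyXD addmC submK //.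
  exact: hg.
- by exists n.+1, (fun i => vev 'X_i) => a; exact: veronese_gr1.
Qed.

(* The homogeneous maximal ideal is the ideal (x^i y^(n-i) | 0 <= i <= n). *)
Fact veronese_maxideal : (0 < n)%N ->
  maxideal veronese_gr =
  [set a | exists c : 'I_n.+1 -> veronese, a = \sum_i c i * vev 'X_i].
Proof.
move=> n_gt0; have sg := veronese_standard_graded n_gt0.
have gr0 d : veronese_gr d 0 by case: (sg_submod sg d).
have grD d a b : veronese_gr d a -> veronese_gr d b -> veronese_gr d (a + b).
  by case: (sg_submod sg d) => _ + _; apply.
have mD a b : maxideal veronese_gr a -> maxideal veronese_gr b ->
    maxideal veronese_gr (a + b).
  have pad N N' (f : nat -> veronese) : (N <= N')%N ->
      \sum_(d < N) f d = \sum_(d < N') (if (d < N)%N then f d else 0).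
    by move=> le; rewrite -big_mkcond (big_ord_widen N').
  move=> [N [f hf ->]] [N' [f' hf' ->]]; exists (maxn N N').
  exists (fun d => (if (d < N)%N then f d else 0)
                 + (if (d < N')%N then f' d else 0)).
    by move=> d; apply: grD; case: ifP.
  by rewrite big_split /= -!pad ?leq_maxl ?leq_maxr.
have m0 : maxideal veronese_gr 0.
  by exists 0%N, (fun=> 0); rewrite ?big_ord0.
pose I : set veronese :=
  [set a | exists c : 'I_n.+1 -> veronese, a = \sum_i c i * vev 'X_i].
have I0 : I 0 by exists (fun=> 0); rewrite big1 // => i _; rewrite mul0r.
have ID a b : I a -> I b -> I (a + b).
  move=> [c ->] [c' ->]; exists (fun i => c i + c' i).
  by rewrite -big_split; apply: eq_bigr => i _; rewrite mulrDl.
apply/seteqP; split=> [_ [N [f hf ->]]|_ [c ->]].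
  apply: (big_ind I) => // i _; have [s hs ->] := sg_gen1 sg (hf i).
  rewrite big_seq; apply: (big_ind I) => // p /hs[/veronese_gr1[c ->] _].
  exists (fun j => c j *: p.2); rewrite mulr_suml; apply: eq_bigr => j _.
  by rewrite -scalerAl mulrC scalerAl.
apply: (big_ind (maxideal veronese_gr)) => // i _.
have [N [f hf ->]] := sg_total sg (c i); exists N, (fun d => f d * vev 'X_i).
  move=> d; rewrite -addn1; apply: sg_mul => //.
  by apply/veronese_grP; exists 'X_i; rewrite ?dhomogX /= ?mdeg1.
by rewrite mulr_suml.
Qed.

End Veronese.

Definition sumset (S : {fset nat}) : {fset nat} :=
  [fset (s + t)%N | s in S, t in S]%fset.

(* {0, 1, ..., n}, that is [n] together with 0 *)
Definition interval0 (n : nat) : {fset nat} := [fset i in iota 0 n.+1]%fset.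

(* Main.v *)
(* For S a subset of {0, ..., n}, the monomial ideal I_S = (x^i y^(n-i) | i in S)
   satisfies mu(I_S) = |S|, since the generators are independent modulo the
   elements of degree at least two.  If S + S = {0, ..., 2n}, every product of
   two generators of m is a product of two generators of I_S, so I_S^2 = m^2.
   For S = {0, n} one gets m^2 <= I_S, so ms <= 2.

   Conversely, let m^2 <= I with mu(I) <= 1, and let e generate I modulo m I.
   Comparing the components of degrees 1 and 2, x^(2n) and y^(2n) are both
   multiples of e_1 if e_1 is nonzero, and of e_2 otherwise.  This forces a
   homogeneous element of positive degree to have leading monomial 1. *)
Require Import Defs.
From mathcomp Require Import all_boot all_order all_algebra.
From mathcomp Require Import finmap boolp classical_sets mpoly.

Local Open Scope classical_set_scope.
Local Open Scope fset_scope.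

(** * Existence of minima of sets of natural numbers *)

Section NatMinimum.
Set Implicit Arguments.
Unset Strict Implicit.
Unset Printing Implicit Defensive.
Local Open Scope nat_scope.

Lemma is_min_exists (P : set nat) (d : nat) : P d -> exists m, is_min P m.
Proof.
move=> Pd; have ex : exists d, `[< P d >] by exists d; apply/asboolP.
case: (ex_minnP ex) => m /asboolP Pm min_m.
by exists m; split=> // m' Pm'; apply: min_m; apply/asboolP.
Qed.

End NatMinimum.

(** * Products of ideals and graded decompositions *)

Section Ideals.
Set Implicit Arguments.
Unset Strict Implicit.
Unset Printing Implicit Defensive.
Import GRing.Theory.
Local Open Scope classical_set_scope.
Local Open Scope ring_scope.
Context {k : fieldType} {A : comAlgType k}.
Implicit Types (I J : set A) (gr : nat -> set A).

Lemma mulset_ideal I J : is_ideal I -> is_ideal (mulset I J).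
Proof.
move=> [I0 _ IM]; split.
- by exists [::]; rewrite ?big_nil.
- move=> _ _ [s hs ->] [t ht ->]; exists (s ++ t); last by rewrite big_cat.
  by move=> p; rewrite mem_cat => /orP[/hs|/ht].
- move=> a _ [s hs ->]; exists [seq (a * p.1, p.2) | p <- s].
    by move=> _ /mapP[p /hs[Ip Jp] ->]; split=> //=; apply: IM.
  by rewrite big_map mulr_sumr; apply: eq_bigr => p _; rewrite mulrA.
Qed.

Lemma mulset_mem I J a b : I a -> J b -> mulset I J (a * b).
Proof.
move=> Ia Jb; exists [:: (a, b)]; last by rewrite big_seq1.
by move=> p; rewrite inE => /eqP ->.
Qed.

Lemma ideal_sum I (T : Type) (r : seq T) (P : pred T) (F : T -> A) :
  is_ideal I -> (forall i, P i -> I (F i)) -> I (\sum_(i <- r | P i) F i).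
Proof. by move=> [I0 ID _] IF; apply: (big_ind I). Qed.

Lemma mulset_sub I J (K : set A) : is_ideal K ->
  (forall a b, I a -> J b -> K (a * b)) -> mulset I J `<=` K.
Proof.
move=> idK IJK _ [s hs ->]; rewrite big_seq.
by apply: ideal_sum => // p /hs[]; apply: IJK.
Qed.

(** Both decompositions are padded with zeros to a common length and added termwise. A general [P]
    lets the pieces also be required to lie in an ideal. *)
Lemma graded_sumD (P : nat -> set A) a b :
  (forall d, P d 0) -> (forall d u v, P d u -> P d v -> P d (u + v)) ->
  (exists N, exists2 f : nat -> A,
     forall d, P d (f d) & a = \sum_(d < N) f d) ->
  (exists N, exists2 f : nat -> A,
     forall d, P d (f d) & b = \sum_(d < N) f d) ->
  exists N, exists2 f : nat -> A,
     forall d, P d (f d) & a + b = \sum_(d < N) f d.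
Proof.
move=> P0 PD.
have pad N N' (f : nat -> A) : (N <= N')%N ->
    \sum_(d < N) f d = \sum_(d < N') (if (d < N)%N then f d else 0).
  by move=> le; rewrite -big_mkcond (big_ord_widen N').
move=> [N [f hf ->]] [N' [f' hf' ->]]; exists (maxn N N').
exists (fun d => (if (d < N)%N then f d else 0)
               + (if (d < N')%N then f' d else 0)).
  by move=> d; apply: PD; case: ifP.
by rewrite big_split /= -!pad ?leq_maxl ?leq_maxr.
Qed.

(** The scalar is the component of degree zero; all the others lie in the maximal ideal. *)
Lemma scalar_mod_maxideal gr a : standard_graded gr ->
  exists c : k, maxideal gr (a - c%:A).
Proof.
move=> sg; have [N [f grf ->]] := sg_total sg a.
have /= := grf 0%N; rewrite (sg_deg0 sg) => -[c fc].
case: N => [|N].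
  exists 0; rewrite big_ord0 scale0r subr0.
  by exists 0%N, (fun=> 0); rewrite ?big_ord0 // => d; case: (sg_submod sg d.+1).
exists c; rewrite big_ord_recl /= fc addrC addKr.
by exists N, (fun d => f d.+1).
Qed.

End Ideals.

(** * Monomial ideals of the Veronese ring, and the bound on generators *)

Section Veronese.
Set Implicit Arguments.
Unset Strict Implicit.
Unset Printing Implicit Defensive.
Import GRing.Theory.
Local Open Scope classical_set_scope.
Local Open Scope ring_scope.
Context {k : fieldType} {n : nat} (n_gt0 : (0 < n)%N).
Let V := veronese k n.
Let gr := @veronese_gr k n.
Let m := maxideal gr.
Let g (i : 'I_n.+1) : V := vev 'X_i.
Let sg : standard_graded gr := veronese_standard_graded k n_gt0.
Implicit Type S : {set 'I_n.+1}.

(** The monomial ideal I_S, where S is the set of exponents of x. *)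
Definition genideal S : set V :=
  [set a | exists c : 'I_n.+1 -> V, a = \sum_(i in S) c i * g i].

Lemma genideal_ideal S : is_ideal (genideal S).
Proof.
split.
- by exists (fun=> 0); rewrite big1 // => i _; rewrite mul0r.
- move=> _ _ [c ->] [c' ->]; exists (fun i => c i + c' i).
  by rewrite -big_split; apply: eq_bigr => i _; rewrite mulrDl.
- move=> a _ [c ->]; exists (fun i => a * c i).
  by rewrite mulr_sumr; apply: eq_bigr => i _; rewrite mulrA.
Qed.

Lemma genideal_gen S i : i \in S -> genideal S (g i).
Proof.
move=> iS; exists (fun j => (i == j)%:R); rewrite (bigD1 i) //= eqxx mul1r.
by rewrite big1 ?addr0 // => j /andP[_ /negPf]; rewrite eq_sym => ->; rewrite mul0r.
Qed.

Lemma genideal_sub S (I : set V) :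
  is_ideal I -> (forall i, i \in S -> I (g i)) -> genideal S `<=` I.
Proof.
move=> idI SI _ [c ->]; apply: ideal_sum => // i iS.
by case: idI => _ _; apply; apply: SI.
Qed.

Lemma maxidealE : m = genideal [set: 'I_n.+1]%SET.
Proof.
rewrite /m /gr veronese_maxideal //; apply/seteqP.
by split=> _ [c ->]; exists c; first symmetry; apply: eq_bigl => i; rewrite inE.
Qed.

Lemma maxideal_ideal : is_ideal m.
Proof. by rewrite maxidealE; apply: genideal_ideal. Qed.

Lemma maxideal_gen i : m (g i).
Proof. by rewrite maxidealE; apply: genideal_gen; rewrite inE. Qed.

Lemma genideal_maxideal S : genideal S `<=` m.
Proof.
apply: (genideal_sub maxideal_ideal) => i _; exact: maxideal_gen.
Qed.

Lemma veronese_gr_gen i : gr 1 (g i).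
Proof. by apply/veronese_grP; exists 'X_i; rewrite ?dhomogX /= ?mdeg1. Qed.

Lemma homogeneous_genideal S : homogeneous gr (genideal S).
Proof.
have [I0 ID IM] := genideal_ideal S.
have P0 d : gr d 0 /\ genideal S 0 by split=> //; case: (sg_submod sg d).
have PD d u v : gr d u /\ genideal S u -> gr d v /\ genideal S v ->
    gr d (u + v) /\ genideal S (u + v).
  move=> [gu Iu] [gv Iv]; split; last exact: ID.
  by case: (sg_submod sg d) => _ + _; apply.
move=> _ [c ->].
apply: (big_ind (fun a => exists N, exists2 f : nat -> V,
  forall d, gr d (f d) /\ genideal S (f d) & a = \sum_(d < N) f d)).
- by exists 0%N, (fun=> 0); rewrite ?big_ord0.
- by move=> a b; exact: (graded_sumD (P := fun d => gr d `&` genideal S)).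
- move=> i iS; have [N [f grf ->]] := sg_total sg (c i).
  (* Multiplying by a generator raises degrees by one, so the piece of degree zero is 0. *)
  exists N.+1, (fun d => if d is d'.+1 then f d' * g i else 0).
    case=> [//|d]; split; last by apply: IM; apply: genideal_gen.
    by rewrite -addn1; apply: sg_mul => //; apply: veronese_gr_gen.
  by rewrite big_ord_recl /= add0r mulr_suml.
Qed.

Lemma valM (a b : V) : val (a * b) = val a * val b.
Proof. exact: rmorphM. Qed.

(* The exponent of x^i y^(n-i). *)
Definition gmon (i : 'I_n.+1) : 'X_{1..2} :=
  (U_(ord0) *+ i + U_(ord_max) *+ (n - i))%MM.

Lemma gmonE i (j : 'I_2) : gmon i j = if j == ord0 then i : nat else (n - i)%N.
Proof.
rewrite mnmDE !mulmnE !mnm1E.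
by case: j => [[|[|j]] lt_j2] //; rewrite -!val_eqE /= ?mul0n ?mul1n ?addn0 ?add0n.
Qed.

Lemma gmon_inj : injective gmon.
Proof. by move=> i j /mnmP/(_ ord0); rewrite !gmonE /= => /val_inj. Qed.

Lemma val_gen i : val (g i) = 'X_[gmon i].
Proof.
rewrite /= comp_mpolyXU -tnth_nth tnth_mktuple mpolyXD -!mpolyXn.
by congr ('X_[U_(_)] ^+ _ * 'X_[U_(_)] ^+ _); apply: val_inj.
Qed.

(** Both products are x^(i+j) y^(2n-i-j). *)
Lemma mul_gen (i j s t : 'I_n.+1) : (i + j = s + t)%N -> g i * g j = g s * g t.
Proof.
move=> e; apply: val_inj; rewrite !valM !val_gen -!mpolyXD; congr 'X_[_]; apply/mnmP => l.
rewrite !(gmonE, mnmDE); case: ifP => // _.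
(* Adding i + j = s + t to the two exponents of y turns both into 2n and removes the truncated
   subtractions. *)
apply/eqP; rewrite -(eqn_add2r (i + j)) {2}e.
by rewrite addnACA !subnK ?leq_ord // addnACA !subnK ?leq_ord.
Qed.

Lemma mulset_maxideal_sub (I : set V) : is_ideal I ->
  (forall i j, I (g i * g j)) -> mulset m m `<=` I.
Proof.
move=> idI gI; have [_ _ IM] := idI.
apply: mulset_sub => // a b; rewrite maxidealE => -[c ->] [c' ->].
rewrite mulr_suml; apply: ideal_sum => // i _.
rewrite mulr_sumr; apply: ideal_sum => // j _.
by rewrite mulrACA; apply: IM.
Qed.

(* Components are taken in k[x,y], where divisibility is tested. *)
Definition vcomp (d : nat) (a : V) : {mpoly k[2]} :=
  pihomog mdeg (n * d)%N (val a).

Lemma vcompD d a b : vcomp d (a + b) = vcomp d a + vcomp d b.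
Proof. by rewrite /vcomp !linearD. Qed.

Lemma vcompZ d (c : k) a : vcomp d (c *: a) = c *: vcomp d a.
Proof. by rewrite /vcomp !linearZ. Qed.

Lemma vcomp0 d : vcomp d 0 = 0.
Proof. by rewrite /vcomp !linear0. Qed.

Lemma vcomp_sum d (T : Type) (r : seq T) (P : pred T) (F : T -> V) :
  vcomp d (\sum_(i <- r | P i) F i) = \sum_(i <- r | P i) vcomp d (F i).
Proof. exact: (big_morph _ (vcompD d) (vcomp0 d)). Qed.

Lemma val_gr d a : gr d a -> val a \is (n * d).-homog.
Proof. by move=> /veronese_grP[q hq ->]; apply: dhomog_vev. Qed.

Lemma vcomp_gr d a : gr d a -> vcomp d a = val a.
Proof. by move=> /val_gr; apply: pihomog_dE. Qed.

Lemma vcomp_gr_ne d e a : gr d a -> d != e -> vcomp e a = 0.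
Proof.
by move=> /val_gr ha ne; apply: pihomog_ne0 ha; rewrite eqn_pmul2l.
Qed.

Lemma vcomp1M a b : m a -> m b -> vcomp 1 (a * b) = 0.
Proof.
move=> [N [f hf ->]] [N' [f' hf' ->]].
rewrite mulr_suml vcomp_sum big1 // => i _.
rewrite mulr_sumr vcomp_sum big1 // => j _.
by rewrite (vcomp_gr_ne (sg_mul sg (hf i) (hf' j))) // addnS.
Qed.

Lemma vcomp2M a b : m a -> m b -> vcomp 2 (a * b) = vcomp 1 a * vcomp 1 b.
Proof.
move=> [N [f hf ->]] [N' [f' hf' ->]].
rewrite mulr_suml !vcomp_sum mulr_suml; apply: eq_bigr => i _.
rewrite mulr_sumr vcomp_sum mulr_sumr; apply: eq_bigr => j _.
have hM := sg_mul sg (hf i) (hf' j).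
have := hf i; have := hf' j; move: hM.
(* Index 0 carries degree one, so only the pair of indices (0, 0) reaches degree two; every other
   pair gives 0 on both sides. *)
case: (nat_of_ord i) => [|i'] hM grj gri; last first.
  by rewrite (vcomp_gr_ne hM) ?addnS ?(vcomp_gr_ne gri) ?mul0r.
move: hM grj; case: (nat_of_ord j) => [|j'] hM grj; last first.
  by rewrite (vcomp_gr_ne hM) // (vcomp_gr_ne grj) ?mulr0.
by rewrite (vcomp_gr hM) (vcomp_gr gri) (vcomp_gr grj) valM.
Qed.

Lemma vcomp1_mulset (I : set V) a : I `<=` m -> mulset m I a -> vcomp 1 a = 0.
Proof.
move=> Im [s hs ->]; rewrite vcomp_sum big_seq big1 // => p /hs[mp Ip].
by apply: vcomp1M => //; apply: Im.
Qed.

Lemma vcomp1_gen i : vcomp 1 (g i) = 'X_[gmon i].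
Proof. by rewrite vcomp_gr ?val_gen //; apply: veronese_gr_gen. Qed.

Lemma is_mu_genideal S : is_mu gr (genideal S) #|S|.
Proof.
have idS := genideal_ideal S.
exists (fun i => g (enum_val i)); split.
- by move=> i; apply/genideal_gen/enum_valP.
(* Independence: elements of m I_S have no component of degree one, where the generators are
   distinct monomials. *)
- move=> c /(vcomp1_mulset (@genideal_maxideal S)).
  rewrite vcomp_sum => c0 i; have := congr1 (mcoeff (gmon (enum_val i))) c0.
  rewrite mcoeff0 raddf_sum /= (bigD1 i) //= vcompZ vcomp1_gen mcoeffZ mcoeffX.
  rewrite eqxx mulr1 big1 ?addr0 // => j ji.
  rewrite vcompZ vcomp1_gen mcoeffZ mcoeffX (inj_eq gmon_inj).
  by rewrite (inj_eq enum_val_inj) (negPf ji) mulr0.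
- move=> _ [c ->].
  (* Spanning: each coefficient is replaced by its constant term, which changes the sum by an
     element of m I_S. *)
  have [l hl] := choice (fun i => scalar_mod_maxideal (c i) sg).
  exists (fun i => l (enum_val i)).
  rewrite -(@big_enum_val _ _ _ _ (mem S) (fun i => l i *: g i)) /= -sumrB.
  have idM : is_ideal (mulset m (genideal S)).
    by apply/mulset_ideal/maxideal_ideal.
  apply: ideal_sum => // i iS; rewrite -[l i *: _]mulr_algl -mulrBl.
  by apply: mulset_mem => //; apply: genideal_gen.
Qed.

(** Leading monomials are multiplicative, so that of p divides two coprime monomials and is 1; by
    homogeneity its degree is d. *)
Lemma homog_common_divisor (d : nat) (p u v : {mpoly k[2]}) (m1 m2 : 'X_{1..2}) :
  p \is d.-homog -> (forall i, m1 i = 0%N \/ m2 i = 0%N) ->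
  p * u = 'X_[m1] -> p * v = 'X_[m2] -> d = 0%N.
Proof.
move=> hp m12 pu pv.
have X0 (m' : 'X_{1..2}) : 'X_[m'] != 0 :> {mpoly k[2]}.
  by apply/eqP => /(congr1 (mcoeff m'))/eqP; rewrite mcoeffX eqxx mcoeff0 oner_eq0.
have /andP[p0 u0] : (p != 0) && (u != 0) by rewrite -negb_or -mulf_eq0 pu.
have /andP[_ v0] : (p != 0) && (v != 0) by rewrite -negb_or -mulf_eq0 pv.
have := congr1 (@mlead _ _) pu; have := congr1 (@mlead _ _) pv.
rewrite !mleadM // !mleadXm => e2 e1.
have p1 : mlead p = 0%MM.
  apply/mnmP => i; rewrite mnm0E; apply/eqP.
  have := m12 i; rewrite -e1 -e2 !mnmDE.
  by case=> /eqP; rewrite addn_eq0 => /andP[].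
by move/dhomogP: hp => /(_ _ (mlead_supp p0)) /=; rewrite p1 mdeg0.
Qed.

(* g i * g i is y^(2n) for i = 0 and x^(2n) for i = n. *)
Lemma not_cyclic_mod_maxideal (I : set V) (e : V) :
  is_ideal I -> homogeneous gr I -> I `<=` m -> mulset m m `<=` I -> I e ->
  ~ (forall a, I a -> exists c : k, mulset m I (a - c *: e)).
Proof.
move=> idI homI Im mmI Ie gen.
have gg i : I (g i * g i) by apply: mmI; apply: mulset_mem; exact: maxideal_gen.
have val_gg i : val (g i * g i) = 'X_[(gmon i + gmon i)].
  by rewrite valM val_gen mpolyXD.
have gr_gg i : gr 2 (g i * g i).
  by apply: (sg_mul sg (d := 1) (e := 1)); exact: veronese_gr_gen.
have comp1 a : I a -> exists c : k, vcomp 1 a = c *: vcomp 1 e.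
  move=> /gen[c /(vcomp1_mulset Im)]; rewrite vcompD -scaleNr vcompZ scaleNr.
  by move/subr0_eq => ->; exists c.
(* In degree two a product from m and I is the product of its linear parts, and by [comp1] the part
   from I is a multiple of that of e. *)
have comp2 a : mulset m I a -> exists u, vcomp 2 a = vcomp 1 e * u.
  move=> [s hs ->]; rewrite vcomp_sum big_seq.
  apply: (big_ind (fun p => exists u, p = vcomp 1 e * u)).
  - by exists 0; rewrite mulr0.
  - by move=> _ _ [u ->] [v ->]; exists (u + v); rewrite mulrDr.
  - move=> p /hs[mp Ip]; have [c ec] := comp1 _ Ip.
    rewrite vcomp2M ?ec //; last exact: Im.
    by exists (c *: vcomp 1 p.1); rewrite mulrC -scalerAl scalerAr.
have disj i : (gmon ord0 + gmon ord0)%MM i = 0%N \/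
              (gmon ord_max + gmon ord_max)%MM i = 0%N.
  by rewrite !(gmonE, mnmDE); case: ifP => _; [left | right; rewrite subnn].
have hd d (a : V) : vcomp d a \is (n * d).-homog by apply: pihomogP.
suff [d d_gt0 H] : exists2 d, (0 < d)%N &
    forall i, exists u, vcomp d e * u = 'X_[(gmon i + gmon i)].
  have [[u eu] [v ev]] := (H ord0, H ord_max).
  have /eqP := homog_common_divisor (hd d e) disj eu ev.
  by rewrite muln_eq0 !eqn0Ngt n_gt0 d_gt0.
(* If e has no linear part, [comp2] makes m I vanish in degree two, so each square is a scalar
   multiple of the degree-two part of e. *)
have [e1|e1] := eqVneq (vcomp 1 e) 0.
  exists 2%N => // i; have [c mI] := gen _ (gg i).
  have [u] := comp2 _ mI.
  rewrite vcompD -scaleNr vcompZ e1 mul0r (vcomp_gr (gr_gg i)) val_gg scaleNr.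
  by move/subr0_eq => ->; exists c%:MP; rewrite mulrC mul_mpolyC.
(* Otherwise comparing degree one forces c = 0, so each square lies in m I and is divisible by the
   linear part of e. *)
exists 1%N => // i; have [c mI] := gen _ (gg i).
have := vcomp1_mulset Im mI.
rewrite vcompD -scaleNr vcompZ (vcomp_gr_ne (gr_gg i)) // add0r => /eqP.
rewrite scaler_eq0 oppr_eq0 (negPf e1) orbF => /eqP c0.
have [u] := comp2 _ mI; rewrite c0 scale0r subr0 (vcomp_gr (gr_gg i)) val_gg => ->.
by exists u.
Qed.

Lemma mu_ge2 (I : set V) (d : nat) :
  is_ideal I -> homogeneous gr I -> I `<=` m -> mulset m m `<=` I ->
  is_mu gr I d -> (2 <= d)%N.
Proof.
move=> idI homI Im mmI [e [Ie _ gen]]; rewrite leqNgt; apply/negP => d_lt2.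
have [I0 _ _] := idI.
case: d d_lt2 e Ie gen => [_|[_|//]] e Ie gen.
  (* Without generators, 0 serves as the single generator. *)
  apply: (not_cyclic_mod_maxideal idI homI Im mmI I0) => a /gen[c].
  by rewrite big_ord0 => ?; exists 0; rewrite scale0r.
apply: (not_cyclic_mod_maxideal idI homI Im mmI (Ie ord0)) => a /gen[c].
by rewrite big_ord1; exists (c ord0).
Qed.

(** * The value of ms, and ideals with square m^2 *)

Lemma is_ms_veronese : is_ms gr 2.
Proof.
split=> [|d [I [idI homI Im mmI mu]]]; last exact: mu_ge2 mu.
exists (genideal [set ord0; ord_max]); split.
- exact: genideal_ideal.
- exact: homogeneous_genideal.
- exact: genideal_maxideal.
- apply: mulset_maxideal_sub; first exact: genideal_ideal.
  have [_ _ IM] := genideal_ideal [set ord0; ord_max].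
  (* Write i + j as (i + j - n) + n or as (i + j) + 0, so one factor is x^n or y^n. *)
  move=> i j; have [ij|ij] := leqP n (i + j).
    have lt : (i + j - n < n.+1)%N.
      by rewrite ltnS leq_subLR; apply: leq_add; exact: leq_ord.
    rewrite (@mul_gen i j (Ordinal lt) ord_max) /= ?subnK //.
    by apply: IM; apply: genideal_gen; rewrite !inE eqxx orbT.
  have lt : (i + j < n.+1)%N by apply: ltnW.
  rewrite (@mul_gen i j (Ordinal lt) ord0) /= ?addn0 //.
  by apply: IM; apply: genideal_gen; rewrite !inE eqxx.
- have := is_mu_genideal [set ord0; ord_max]; rewrite cards2.
  by rewrite -val_eqE /= eq_sym -lt0n n_gt0.
Qed.

Lemma genideal_square S :
  (forall i j : 'I_n.+1, exists s t,
     [/\ s \in S, t \in S & (i + j = s + t)%N]) ->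
  mulset (genideal S) (genideal S) = mulset m m.
Proof.
move=> SS; have idS := genideal_ideal S; apply/seteqP; split.
  apply: mulset_sub => [|a b aS bS]; first exact/mulset_ideal/maxideal_ideal.
  by apply: mulset_mem; apply: genideal_maxideal; eassumption.
apply: mulset_maxideal_sub => [|i j]; first exact: mulset_ideal.
have [s [t [sS tS /mul_gen ->]]] := SS i j.
by apply: mulset_mem; apply: genideal_gen.
Qed.

End Veronese.

(** * Sumsets of sets of natural numbers *)

Section SumBasis.
Set Implicit Arguments.
Unset Strict Implicit.
Unset Printing Implicit Defensive.
Local Open Scope nat_scope.

Lemma in_interval0 (n i : nat) : (i \in interval0 n) = (i <= n).
Proof.
by rewrite /interval0 in_fset -[in_mem _ _]/(i \in iota 0 n.+1) mem_iota add0n ltnS.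
Qed.

(** This shows that the minimum over S in the theorem is taken over a nonempty set. *)
Lemma sumset_interval0 (n : nat) : sumset (interval0 n) = interval0 (2 * n).
Proof.
apply/fsetP => i; rewrite in_interval0 mul2n -addnn; apply/imfset2P/idP.
  move=> [s]; rewrite in_interval0 => sn [t]; rewrite in_interval0 => tn ->.
  exact: leq_add.
move=> le; exists (minn i n); rewrite /= ?in_interval0 ?geq_minr //.
exists (i - minn i n); rewrite /= ?in_interval0 ?subnKC ?geq_minl //.
by rewrite leq_subLR; case: (leqP i n) => // ?; rewrite leq_addr.
Qed.

Lemma card_ord_fset (n : nat) (S : {fset nat}) : (S `<=` interval0 n)%fset ->
  #|[set i : 'I_n.+1 | val i \in S]%SET| = #|` S|.
Proof.
move=> /fsubsetP Sn; rewrite cardE -(size_map val).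
apply: perm_size; apply: uniq_perm; rewrite ?fset_uniq //.
  by rewrite map_inj_uniq ?enum_uniq //; apply: val_inj.
move=> i; apply/mapP/idP => [[j]|iS]; first by rewrite mem_enum inE => ? ->.
have := Sn _ iS; rewrite in_interval0 -ltnS => lt.
by exists (Ordinal lt); rewrite // mem_enum inE.
Qed.

End SumBasis.

Theorem proposition4p15 (k : fieldType) (n : nat) (n_gt0 : (1 <= n)%N) :
  is_ms (@veronese_gr k n) 2 /\
  exists c s : nat,
    [/\ is_cs (@veronese_gr k n) c,
        is_min [set d | exists S : {fset nat},
          [/\ (S `<=` interval0 n)%fset, sumset S = interval0 (2 * n)
            & d = #|` S|]] s
      & (c <= s)%N].
Proof.
split; first exact: is_ms_veronese.
have [s min_s] : exists s, is_min [set d | exists S : {fset nat},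
    [/\ (S `<=` interval0 n)%fset, sumset S = interval0 (2 * n)
      & d = #|` S|]] s.
  apply: (@is_min_exists _ #|` interval0 n|); exists (interval0 n).
  by split; rewrite ?sumset_interval0.
have [[S [Sn SS sE]] _] := min_s.
(* The ideal I_S of an optimal S realizes s as a value of mu; hence cs has a value, and it is at
   most s. *)
have Ps : [set d | exists I : set (veronese k n),
    [/\ is_ideal I, homogeneous (@veronese_gr k n) I,
        (I `<=` maxideal (@veronese_gr k n))%classic,
        mulset I I = mulset (maxideal (@veronese_gr k n))
                            (maxideal (@veronese_gr k n))
      & is_mu (@veronese_gr k n) I d]]%classic s.
  exists (genideal [set i : 'I_n.+1 | val i \in S]%SET); split.
  - exact: genideal_ideal.
  - exact: homogeneous_genideal.
  - exact: genideal_maxideal.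
  - apply: genideal_square => // i j.
    have : (i + j)%N \in sumset S.
      by rewrite SS in_interval0 mul2n -addnn leq_add // leq_ord.
    move=> /imfset2P[a /= aS [b /= bS eab]].
    have lt c : c \in S -> (c < n.+1)%N.
      by move/(fsubsetP Sn); rewrite in_interval0.
    by exists (Ordinal (lt _ aS)), (Ordinal (lt _ bS)); rewrite !inE.
  - by rewrite sE -(card_ord_fset Sn); apply: is_mu_genideal.
have [c min_c] := is_min_exists Ps.
by exists c, s; split=> //; case: min_c => _; apply.
Qed.
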